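(* Let $m\ge1$, $b_1=2m$, $b_2=4m-1$. Identify the residues modulo $2m-1$ with the even residues modulo $2(2m-1)$ via the group isomorphism $[i \bmod 2(2m-1)]\mapsto[i\bmod (2m-1)]$, so that $I^{(b_1)}\cong I^{(b_2)}=:I$. Then for any $n\ge1$ and any $i\in I$, $$K^{(b_1)}_i(n)=\alpha_1\mathcal{B}^{(b_1)}(n_1)+\dots+\alpha_t\mathcal{B}^{(b_1)}(n_t)+K^{(b_1)}_\beta(1)$$ is a representation of $K_i^{(b_1)}(n)$ of the form described below if and only if $$K^{(b_2)}_i(n)=\alpha_1\mathcal{B}^{(b_2)}(n_1)+\dots+\alpha_t\mathcal{B}^{(b_2)}(n_t)+K^{(b_2)}_\beta(1)$$ is a representation of $K_i^{(b_2)}(n)$ (with the same $t$, $\alpha_j$, $n_j$, $\beta$).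
   Context: For a base $b\ge2$: $s(v)$ is the sum of the base-$b$ digits of $v\in\mathbb{N}$, $f(v)=v+s(v)$, $F(u)=|\{v\in\mathbb{N}: f(v)=u\}|$, $K(n)$ is the smallest $u$ with $F(u)=n$, $B(n)=\lfloor\log_bK(n)\rfloor$ and $\mathcal{B}(n)=b^{B(n)}+1$ for $n\ge2$. The index set $I^{(b)}$ is the set of residues modulo $b-1$ if $b$ is even and the set of even residues modulo $b-1$ if $b$ is odd; $K_i(n)$ is the smallest $u$ with $F(u)=n$ and $u\equiv i\pmod{b-1}$. Superscripts $(b)$ indicate the base. A representation of $K_i(n)$ means an expression $K_i(n)=\alpha_1\mathcal{B}(n_1)+\dots+\alpha_t\mathcal{B}(n_t)+K_\beta(1)$ with $t\ge0$, integers $\alpha_j\in[1,b-1]$ if $b$ even or $[1,\frac{b-1}{2}]$ if $b$ odd, $\beta\in I$, and (if $t>0$) $n_1=n>n_2>\dots>n_t$ with $n_j\in\{\lfloor n_{j-1}/2\rfloor,\lceil n_{j-1}/2\rceil\}$ and $n_t\in\{2,3\}$; such a representation exists and is unique. *)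

(* Defs.v *)
From mathcomp Require Import all_boot.
From mathcomp Require Import boolp zify.

Set Implicit Arguments.
Unset Strict Implicit.
Unset Printing Implicit Defensive.

(* The natural numbers include 0, so that K_0(1) = K(1) = 0. *)

(* The k-th base-b digit of v is (v %/ b ^ k) %% b; it vanishes for k >= v
   because v < b ^ v when b >= 2. *)
Definition digit_sum (b v : nat) : nat := \sum_(k < v) (v %/ b ^ k) %% b.

Definition f (b v : nat) : nat := v + digit_sum b v.

(* All generators of u: the bound v <= u loses nothing, since v <= f b v
   (see mem_generators). *)
Definition generators (b u : nat) : seq nat :=
  [seq v <- iota 0 u.+1 | f b v == u].

Definition F (b u : nat) : nat := size (generators b u).

Lemma generators_uniq b u : uniq (generators b u).
Proof. exact: filter_uniq (iota_uniq _ _). Qed.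

Lemma mem_generators b u v : (v \in generators b u) = (f b v == u).
Proof.
rewrite mem_filter mem_iota leq0n add0n ltnS /=.
by case: eqP => //= <-; rewrite leq_addr.
Qed.

(* The least natural number satisfying P (0 if there is none). *)
Definition least (P : pred nat) : nat :=
  if pselect (exists u, P u) is left exP then ex_minn exP else 0.

Definition K (b n : nat) : nat := least (fun u => F b u == n).

Definition Kres (b i n : nat) : nat :=
  least (fun u => (F b u == n) && (u == i %[mod b.-1])).

(* The exponent is B(n) = floor (log_b (K n)), meaningful for n >= 2. *)
Definition B (b n : nat) : nat := trunc_log b (K b n).

Definition calB (b n : nat) : nat := b ^ B b n + 1.

(* Residues modulo b - 1 are represented by 0, ..., b - 2; when b is odd the
   modulus is even, so the parity of a residue is that of its representative. *)
Definition index_set (b : nat) : pred nat :=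
  fun i => (i < b.-1) && (odd b ==> ~~ odd i).

Definition alpha_max (b : nat) : nat := if odd b then (b.-1)./2 else b.-1.

(* Only the values of alpha and nu at 1, ..., t matter. *)
Definition is_representation (b n i t : nat) (alpha nu : nat -> nat)
    (beta : nat) : Prop :=
  [/\ Kres b i n =
        \sum_(1 <= j < t.+1) alpha j * calB b (nu j) + Kres b beta 1,
      forall j, 1 <= j <= t -> 1 <= alpha j <= alpha_max b,
      index_set b beta &
      0 < t ->
        [/\ nu 1 = n,
            forall j, 1 <= j < t ->
              nu j.+1 < nu j /\
              (nu j.+1 = (nu j)./2 \/ nu j.+1 = uphalf (nu j)) &
            nu t = 2 \/ nu t = 3]].

(* The isomorphism from the even residues modulo 2(2m-1) to the residues
   modulo 2m-1. *)
Definition residue_iso (m i : nat) : nat := i %% (2 * m - 1).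

Lemma residue_iso_morph m i j :
  residue_iso m ((i + j) %% (4 * m - 1).-1) =
  (residue_iso m i + residue_iso m j) %% (2 * m - 1).
Proof.
rewrite /residue_iso modnDm modn_dvdm //.
have -> : (4 * m - 1).-1 = 2 * (2 * m - 1) by lia.
exact: dvdn_mull.
Qed.

Lemma residue_iso_index_set m i : 0 < m ->
  index_set (4 * m - 1) i -> index_set (2 * m) (residue_iso m i).
Proof.
move=> m_gt0 _; rewrite /index_set /residue_iso oddM /= andbT -subn1.
by rewrite ltn_mod; lia.
Qed.

Lemma residue_iso_inj m : 0 < m ->
  {in index_set (4 * m - 1) &, injective (residue_iso m)}.
Proof.
move=> m_gt0 i j; rewrite !unfold_in /residue_iso.
have -> : odd (4 * m - 1) by lia.
move=> /andP[i_lt i_even] /andP[j_lt j_even] eq_ij.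
have := divn_eq i (2 * m - 1); have := divn_eq j (2 * m - 1).
rewrite eq_ij; move: (j %% _) => r.
have : i %/ (2 * m - 1) < 2 by rewrite ltn_divLR; lia.
have : j %/ (2 * m - 1) < 2 by rewrite ltn_divLR; lia.
case: (i %/ _) => [|[|//]]; case: (j %/ _) => [|[|//]] _ _; lia.
Qed.

Lemma residue_iso_surj m k : 0 < m -> index_set (2 * m) k ->
  exists2 i, index_set (4 * m - 1) i & residue_iso m i = k.
Proof.
rewrite /index_set /residue_iso => m_gt0 /andP[k_lt _].
have k_lt' : k < 2 * m - 1 by lia.
exists (k + odd k * (2 * m - 1)); last by rewrite addnC modnMDl modn_small.
by case: (boolP (odd k)) => k_odd; lia.
Qed.

(* Main.v *)
Require Import Defs.
From mathcomp Require Import all_boot.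
From mathcomp Require Import boolp zify.

(* Complementing the lower k digits gives, for u = a (b^k + 1) + x with
   1 <= a < b and 0 <= x <= b^k, the recursion F(u) = F(x) + F(k (b - 1) - 2 - x).
   Let N = 2m - 1: for both bases the admissible residues are the classes of 2c
   modulo b - 1, with c ranging modulo N, and a = 1, ..., N realises each class
   of 2a exactly once. So B(n) is the least k for which k (b - 1) - 2 is of the
   form K_d(p) + K_{-1-d}(n - p), where K_d stands for K_{2d}, and
   K_c(n) = a calB(n) + K_d(p) with a + d = c, where a, and then K_d(p), is least
   subject to (d, p) attaining that minimum. Since 2 K_c(n) < calB(n + 1) for
   n >= 2, such p are the two halves of n, and sums of two values K_c(p), with p in
   {g, g + 1}, compare lexicographically in the coefficients of calB(g + 1),
   calB(g), ... Hence they compare in the same way in both bases, so that the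
   recursion makes the same choices of a, d and p in both. *)

Set Implicit Arguments.
Unset Strict Implicit.
Unset Printing Implicit Defensive.

(** * The recursion for F *)

Section Generators.

Variable b : nat.
Hypothesis b_gt1 : 1 < b.

Lemma digit_sum_widen v M : v <= M ->
  digit_sum b v = \sum_(k < M) (v %/ b ^ k) %% b.
Proof.
move=> v_le; rewrite /digit_sum -!(big_mkord xpredT (fun k => (v %/ b ^ k) %% b)).
rewrite [RHS](big_cat_nat (n := v)) //= [X in _ = _ + X]big_nat_cond.
rewrite [X in _ = _ + X]big1 ?addn0 // => k /andP[/andP[vk _] _].
rewrite divn_small ?mod0n //; apply: leq_trans (ltn_expl v b_gt1) _.
by rewrite leq_exp2l.
Qed.

Lemma digit_sum_rec v : digit_sum b v = v %% b + digit_sum b (v %/ b).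
Proof.
rewrite (@digit_sum_widen v v.+1) // big_ord_recl expn0 divn1.
rewrite (@digit_sum_widen (v %/ b) v) ?leq_div //; congr (_ + _).
by apply: eq_bigr => k _; rewrite /= expnS divnMA.
Qed.

Lemma digit_sum0 : digit_sum b 0 = 0.
Proof. by rewrite /digit_sum big_ord0. Qed.

Lemma digit_sum_small v : v < b -> digit_sum b v = v.
Proof. by move=> v_lt; rewrite digit_sum_rec modn_small // divn_small // digit_sum0 addn0. Qed.

Lemma digit_sum_top k a w : a < b -> w < b ^ k ->
  digit_sum b (a * b ^ k + w) = a + digit_sum b w.
Proof.
have b_gt0 : 0 < b by lia.
move=> a_lt; elim: k w => [|k IH] w.
  by rewrite expn0 ltnS leqn0 => /eqP->; rewrite muln1 addn0 digit_sum0 addn0 digit_sum_small.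
move=> w_lt; rewrite digit_sum_rec (digit_sum_rec w).
rewrite expnSr mulnA modnMDl divnMDl // IH 1?addnCA //.
by rewrite ltn_divLR // -expnSr.
Qed.

(** Subtraction from [b ^ k - 1] never borrows: each of the [k] digits [r] becomes [b - 1 - r]. *)
Lemma digit_sum_compl k w : w < b ^ k ->
  digit_sum b (b ^ k - 1 - w) + digit_sum b w = k * b.-1.
Proof.
have b_gt0 : 0 < b by lia.
elim: k w => [|k IH] w; first by rewrite expn0 ltnS leqn0 => /eqP->; rewrite digit_sum0.
move=> w_lt; rewrite digit_sum_rec (digit_sum_rec w).
have q_lt : w %/ b < b ^ k by rewrite ltn_divLR // -expnSr.
have r_lt : w %% b < b by rewrite ltn_mod.
have -> : b ^ k.+1 - 1 - w = (b ^ k - 1 - w %/ b) * b + (b - 1 - w %% b).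
  rewrite {1}(divn_eq w b) expnSr !mulnBl mul1n.
  have : (w %/ b).+1 * b <= b ^ k * b by rewrite leq_mul2r q_lt orbT.
  rewrite mulSn; move: (w %/ b * b) (b ^ k * b) r_lt; move: (w %% b) => r Q X; clear; lia.
rewrite modnMDl divnMDl // (@divn_small (b - 1 - w %% b)) ?addn0; last by lia.
rewrite (@modn_small (b - 1 - w %% b)); last by lia.
have := IH _ q_lt; rewrite mulSn; lia.
Qed.

Lemma digit_sum_gt0 v : 0 < v -> 0 < digit_sum b v.
Proof.
elim/ltn_ind: v => v IH v_gt0; case: (ltnP v b) => [/digit_sum_small->//|v_ge].
rewrite digit_sum_rec addn_gt0 IH ?orbT ?ltn_Pdiv // divn_gt0; lia.
Qed.

Lemma digit_sum_mod v : digit_sum b v = v %[mod b.-1].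
Proof.
elim/ltn_ind: v => v IH; case: (ltnP v b) => [/digit_sum_small->//|v_ge].
rewrite digit_sum_rec -modnDmr (IH (v %/ b)) ?ltn_Pdiv //; last lia.
rewrite modnDmr {3}(divn_eq v b).
have -> : v %/ b * b + v %% b = v %/ b * b.-1 + (v %% b + v %/ b).
  by rewrite -{2}(prednK (ltnW b_gt1)) mulnS; lia.
by rewrite modnMDl.
Qed.

Lemma f_mod v : f b v = 2 * v %[mod b.-1].
Proof. by rewrite /f -modnDmr digit_sum_mod modnDmr mul2n addnn. Qed.

Lemma f_top k a w : a < b -> w < b ^ k ->
  f b (a * b ^ k + w) = a * (b ^ k + 1) + f b w.
Proof. by move=> a_lt w_lt; rewrite /f digit_sum_top // mulnDr; lia. Qed.

Lemma f_compl k w : w < b ^ k ->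
  f b (b ^ k - 1 - w) + f b w + 1 = b ^ k + k * b.-1.
Proof. by move=> w_lt; have := digit_sum_compl w_lt; rewrite /f; lia. Qed.

Lemma F_sum u M : u < M -> F b u = \sum_(0 <= v < M) (f b v == u).
Proof.
move=> u_lt; rewrite /F /generators size_filter -sum1_count big_mkcond /=.
rewrite (big_cat_nat (n := u.+1)) //= [X in _ = _ + X]big_nat_cond.
rewrite [X in _ = _ + X]big1 ?addn0 => [|v /andP[/andP[uv _] _]].
  by rewrite /index_iota subn0; apply: eq_bigr => v _; case: eqP.
by rewrite /f; case: eqP => //; lia.
Qed.

(** The endpoint [u = b ^ k] is allowed because [f b (b ^ k)] exceeds [b ^ k]. *)
Lemma F_sum_exp u k : u <= b ^ k -> F b u = \sum_(0 <= v < b ^ k) (f b v == u).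
Proof.
move=> u_le; rewrite (@F_sum u (b ^ k).+1) // big_nat_recr //=.
have := @digit_sum_gt0 (b ^ k); rewrite expn_gt0 (ltnW b_gt1) => /(_ isT).
by rewrite /f; case: eqP; lia.
Qed.

Lemma expnS_pred k : b ^ k.+1 = b ^ k + b.-1 * b ^ k.
Proof. by rewrite expnS -{1}(prednK (ltnW b_gt1)) mulSn. Qed.

Lemma expn_bernoulli k : k * b.-1 < b ^ k.
Proof.
elim: k => [|k IH]; first by rewrite expn0.
rewrite expnS_pred mulSn; have : b.-1 <= b.-1 * b ^ k by rewrite leq_pmulr ?expn_gt0; lia.
lia.
Qed.

(* The generators of a (b^k + 1) + x have leading part a or a - 1; complementing the
   lower k digits turns those with leading part a - 1 into generators of
   k (b - 1) - 2 - x. *)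
Lemma F_rec k a x : 0 < a -> a < b -> x <= b ^ k ->
    a * (b ^ k + 1) + x <= b ^ k.+1 ->
  F b (a * (b ^ k + 1) + x) =
    F b x + (if x + 2 <= k * b.-1 then F b (k * b.-1 - 2 - x) else 0).
Proof.
move=> a_gt0 a_lt x_le u_le; rewrite (F_sum_exp u_le).
have bk_gt0 : 0 < b ^ k by rewrite expn_gt0 ltnW.
have bern := expn_bernoulli k.
rewrite expnS big_nat_mul /=.
have inner a' : a' < b ->
    \sum_(a' * b ^ k <= j < a'.+1 * b ^ k) (f b j == a * (b ^ k + 1) + x) =
    \sum_(0 <= w < b ^ k) (a' * (b ^ k + 1) + f b w == a * (b ^ k + 1) + x).
  move=> a'_lt; rewrite -{1}(add0n (a' * b ^ k)) big_addn mulSn addnK.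
  rewrite big_nat_cond [RHS]big_nat_cond; apply: eq_bigr => w /andP[/andP[_ w_lt] _].
  by rewrite addnC f_top.
have fw_le w : w < b ^ k -> f b w < b ^ k + k * b.-1.
  by move=> w_lt; have := f_compl w_lt; lia.
(* As [f b w < 2 * b ^ k] and [x <= b ^ k], only the leading parts [a - 1] and [a] contribute. *)
have zero a' : (a' < a.-1) || (a < a') ->
    \sum_(0 <= w < b ^ k) (a' * (b ^ k + 1) + f b w == a * (b ^ k + 1) + x) = 0.
  move=> a'P; rewrite big_nat_cond big1 // => w /andP[/andP[_ w_lt] _].
  have := fw_le _ w_lt; case: eqP => // eq fw.
  case/orP: a'P => [lt|lt].
    have : a'.+2 * (b ^ k + 1) <= a * (b ^ k + 1) by rewrite leq_mul2r; lia.
    by rewrite !mulSn; lia.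
  have : a.+1 * (b ^ k + 1) <= a' * (b ^ k + 1) by rewrite leq_mul2r; lia.
  by rewrite !mulSn; lia.
rewrite big_nat (eq_bigr (fun a' => \sum_(0 <= w < b ^ k)
   (a' * (b ^ k + 1) + f b w == a * (b ^ k + 1) + x))); last by move=> a' /andP[_ /inner].
rewrite -big_nat (big_cat_nat (n := a.-1)) //=; last by lia.
rewrite [X in X + _]big_nat [X in X + _]big1 => [|a' /andP[_ lt]]; last by rewrite zero ?lt.
rewrite add0n (big_cat_nat (n := a.+1)) //=; last by lia.
rewrite [X in _ + X]big_nat [X in _ + X]big1 => [|a' /andP[lt _]]; last by rewrite zero ?lt ?orbT.
rewrite addn0 big_nat_recr /=; last by lia.
have -> : index_iota a.-1 a = [:: a.-1].
  by rewrite /index_iota (_ : a - a.-1 = 1) //; lia.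
rewrite big_seq1 addnC; congr (_ + _).
  by rewrite (F_sum_exp x_le); apply: eq_bigr => w _; rewrite eqn_add2l.
have shift : a * (b ^ k + 1) = a.-1 * (b ^ k + 1) + (b ^ k + 1).
  by rewrite -{1}(prednK a_gt0) mulSn addnC.
(* If [k * b.-1 < x + 2], the required value [f b w = x + b ^ k + 1] is beyond all those with
   [w < b ^ k]. *)
case: leqP => [x_small|x_big].
  rewrite (@F_sum_exp _ k); last by lia.
  rewrite big_nat_rev /= big_nat [RHS]big_nat; apply: eq_bigr => w /andP[_ w_lt].
  have -> : 0 + b ^ k - w.+1 = b ^ k - 1 - w by lia.
  have := f_compl w_lt; rewrite shift => fc; congr nat_of_bool.
  by apply/eqP/eqP; lia.
rewrite big_nat big1 // => w /andP[_ w_lt]; have := fw_le _ w_lt.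
by rewrite shift; case: eqP => //; lia.
Qed.

End Generators.

(** * Exponents and residues *)

Lemma leastP (P : pred nat) : (exists u, P u) ->
  P (least P) /\ forall u, P u -> least P <= u.
Proof.
by rewrite /least; case: pselect => // exP _; case: ex_minnP => u Pu u_min; split.
Qed.

(* [N] is the number of admissible residues, which are the classes of [2 * c]
   modulo [b - 1] for [c] modulo [N]; it is also [alpha_max b]. *)
Definition residue_count (b N : nat) : Prop :=
  0 < N /\ (b = N.+1 /\ odd N \/ b = N.*2.+1).

Section Exponents.

Variables b N : nat.
Hypothesis bN : residue_count b N.

Notation Kc c n := (Kres b (2 * c) n).

Lemma N_gt0 : 0 < N. Proof. by case: bN. Qed.

Lemma b_gt1 : 1 < b. Proof. by case: bN => N0 [[-> _]|->]; lia. Qed.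

Lemma N_ltb : N < b. Proof. by case: bN => N0 [[-> _]|->]; lia. Qed.

(** If [b = N + 1], then [N] is odd and 2 is invertible modulo [N]; if [b = 2 * N + 1], the factor 2
    cancels in the modulus. *)
Lemma double_mod x y : (2 * x == 2 * y %[mod b.-1]) = (x == y %[mod N]).
Proof.
wlog: x y / x <= y => [wl|xy].
  by case/orP: (leq_total x y) => /wl // h; rewrite eq_sym h eq_sym.
rewrite eq_sym [RHS]eq_sym !eqn_mod_dvd ?leq_mul2l ?xy // -mulnBr.
case: bN => _ [[-> oddN]|->] /=; first by rewrite Gauss_dvdr // coprimen2.
by rewrite -mul2n dvdn_pmul2l.
Qed.

Lemma doubleP x y : 2 * x = 2 * y %[mod b.-1] <-> x = y %[mod N].
Proof. by split=> /eqP h; apply/eqP; rewrite ?double_mod // -double_mod. Qed.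

Lemma Kc_mod c c' n : c = c' %[mod N] -> Kc c n = Kc c' n.
Proof. by move=> /doubleP e; rewrite /Kres e. Qed.

Lemma KcP c n : (exists2 u, F b u = n & u = 2 * c %[mod b.-1]) ->
  [/\ F b (Kc c n) = n, Kc c n = 2 * c %[mod b.-1] &
      forall u, F b u = n -> u = 2 * c %[mod b.-1] -> Kc c n <= u].
Proof.
case=> u Fu ru; case: (@leastP (fun u => (F b u == n) && (u == 2 * c %[mod b.-1]))).
  by exists u; rewrite Fu ru !eqxx.
case/andP => /eqP FK /eqP rK K_min; split=> // v Fv rv.
by apply: K_min; rewrite Fv rv !eqxx.
Qed.

Lemma F_gt0 u : 0 < F b u -> exists v, f b v = u.
Proof.
rewrite /F; case E: (generators b u) => [//|v s] _; exists v.
by apply/eqP; rewrite -mem_generators E mem_head.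
Qed.

Lemma F_gt0_mod u : 0 < F b u -> exists c, u = 2 * c %[mod b.-1].
Proof. by case/F_gt0 => v <-; exists v; rewrite (f_mod b_gt1). Qed.

Lemma N_dvd : N %| b.-1.
Proof. by case: bN => _ [[-> _]|->] //=; rewrite -mul2n dvdn_mull. Qed.

Lemma digit_sum_modN v : digit_sum b v = v %[mod N].
Proof.
by rewrite -(modn_dvdm _ N_dvd) (digit_sum_mod b_gt1) (modn_dvdm _ N_dvd).
Qed.

Lemma generator_ge v : v %% N <= digit_sum b v.
Proof. by rewrite -digit_sum_modN leq_mod. Qed.

(** A generator of [u] and its digit sum are both congruent to [c] modulo [N], hence both at least
    [c %% N]. *)
Lemma F_gt0_ge c u : 0 < F b u -> u = 2 * c %[mod b.-1] -> 2 * (c %% N) <= u.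
Proof.
case/F_gt0 => v <-; rewrite (f_mod b_gt1) => /doubleP <-.
have := generator_ge v; have := leq_mod v N; rewrite /f; lia.
Qed.

Lemma F_double r : r < N -> F b (2 * r) = 1.
Proof.
move=> r_lt; have r_ltb := ltn_trans r_lt N_ltb.
have gen v : (v \in generators b (2 * r)) = (v == r).
  rewrite mem_generators; apply/eqP/eqP => [fv|->]; last first.
    by rewrite /f (digit_sum_small b_gt1) //; lia.
  have vr : v %% N = r.
    by rewrite -(modn_small r_lt); apply/doubleP; rewrite -fv (f_mod b_gt1).
  have := generator_ge v; have := leq_mod v N; rewrite vr; move: fv; rewrite /f; lia.
have /perm_size e : perm_eq (generators b (2 * r)) [:: r].
  by apply: uniq_perm => [||v]; rewrite ?generators_uniq // gen inE.
by rewrite /F e.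
Qed.

Lemma Kc1 c : Kc c 1 = 2 * (c %% N).
Proof.
have r_lt : c %% N < N by rewrite ltn_mod N_gt0.
have F1 := F_double r_lt.
have r_mod : 2 * (c %% N) = 2 * c %[mod b.-1] by apply/doubleP; rewrite modn_mod.
case: (@KcP c 1); first by exists (2 * (c %% N)).
move=> FK rK K_min; apply/eqP; rewrite eqn_leq K_min // F_gt0_ge //.
by rewrite FK.
Qed.

Lemma F0 : F b 0 = 1.
Proof. by rewrite -(muln0 2) F_double ?N_gt0. Qed.

Lemma expn_bernoulli2 k : 2 <= k -> k.+1 * b.-1 < b ^ k.
Proof.
have b_gt1 := b_gt1.
elim: k => // k IH; rewrite leq_eqVlt => /orP[/eqP <-|k_ge].
  by rewrite -(prednK (ltnW b_gt1)) /=; move: b.-1 => c; nia.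
have : b.-1 <= b.-1 * b ^ k by rewrite leq_pmulr // expn_gt0; lia.
have := IH k_ge; rewrite (expnS_pred b_gt1) mulSn; lia.
Qed.

(** Leaves room below [b ^ k.+1] for every [a <= N] and [x + 2 <= k * b.-1] in [F_rec]. If
    [b = N + 1], the hypothesis gives [2 <= k], as the sharper bound on [b ^ k] demands. *)
Lemma exponent_room k : 2 * N <= k * b.-1 -> N * (b ^ k + 1) + k * b.-1 < b ^ k.+1 + 2.
Proof.
have b_gt1 := b_gt1; rewrite (expnS_pred b_gt1); case: (bN) => N0 [[bE _]|bE].
  have bp : b.-1 = N by rewrite bE.
  rewrite bp leq_mul2r => kN; have k2 : 2 <= k by lia.
  by have := expn_bernoulli2 k2; rewrite bp mulSn mulnDr; lia.
have bp : b.-1 = 2 * N by rewrite bE mul2n.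
have := expn_bernoulli b_gt1 k; rewrite bp => bern _.
have : N <= N * b ^ k by rewrite leq_pmulr // expn_gt0; lia.
by rewrite mulnDr -mulnA; lia.
Qed.

Definition splits n k := exists x y,
  [/\ F b x + F b y = n, 0 < F b x, 0 < F b y & x + y + 2 = k * b.-1].

Lemma complement_mod x y c c' : x = 2 * c %[mod b.-1] -> y = 2 * c' %[mod b.-1] ->
  (b.-1 %| x + y + 2) = (N %| c + c' + 1).
Proof.
move=> xc yc.
rewrite /dvdn -modnDml -(modnDm x) xc yc modnDm modnDml.
have -> : 2 * c + 2 * c' + 2 = 2 * (c + c' + 1) by lia.
by have := double_mod (c + c' + 1) 0; rewrite muln0 !mod0n.
Qed.

(** For the residues [r] and [r'] of the two classes, [r + r' + 1] is a positive multiple of [N],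
    while [x >= 2 * r] and [y >= 2 * r']. *)
Lemma complement_ge x y : 0 < F b x -> 0 < F b y -> b.-1 %| x + y + 2 ->
  2 * N <= x + y + 2.
Proof.
move=> Fx Fy; have [c xc] := F_gt0_mod Fx; have [c' yc'] := F_gt0_mod Fy.
have := F_gt0_ge Fx xc; have := F_gt0_ge Fy yc'; rewrite (complement_mod xc yc').
have -> : (N %| c + c' + 1) = (N %| c %% N + c' %% N + 1).
  by rewrite /dvdn -modnDml -(modnDm c) modnDml.
move: (c %% N) (c' %% N) => r r' y_ge x_ge /dvdn_leq; rewrite addn1 => /(_ isT) rr.
clear -rr x_ge y_ge.
lia.
Qed.

Lemma F_build a k x y : 0 < a <= N -> 0 < F b x -> 0 < F b y ->
    x + y + 2 = k * b.-1 ->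
  F b (a * (b ^ k + 1) + x) = F b x + F b y /\ a * (b ^ k + 1) + x < b ^ k.+1.
Proof.
case/andP=> a_gt0 a_le Fx Fy xy.
have : 2 * N <= k * b.-1 by rewrite -xy complement_ge // xy dvdn_mull.
move/exponent_room => room.
have : a * (b ^ k + 1) <= N * (b ^ k + 1) by rewrite leq_mul2r a_le orbT.
move=> aN; have lt : a * (b ^ k + 1) + x < b ^ k.+1 by lia.
have bern := expn_bernoulli b_gt1 k.
split=> //; rewrite (F_rec b_gt1) //; [|have := N_ltb; lia|lia|lia].
by rewrite ifT; [congr (_ + F b _)|]; lia.
Qed.

(** Division by [b ^ k + 1] puts [u] in the form of [F_rec]. If one of the two counts vanishes, the
    other equals [F b u] at an argument at most [b ^ k], which suits an induction on [u]. *)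
Lemma F_decomp k u : b ^ k < u -> u <= b ^ k.+1 -> 1 < F b u ->
  exists a x, [/\ u = a * (b ^ k + 1) + x, 0 < a & x <= b ^ k] /\
   (F b x = F b u \/ exists2 y, y < b ^ k & F b y = F b u \/
     [/\ F b x + F b y = F b u, 0 < F b x, 0 < F b y & x + y + 2 = k * b.-1]).
Proof.
move=> u_gt u_le Fu; have bern := expn_bernoulli b_gt1 k; have b_gt1 := b_gt1.
have uE := divn_eq u (b ^ k + 1).
set a := u %/ _ in uE; set x := u %% _ in uE.
have x_lt : x < b ^ k + 1 by rewrite ltn_mod addn1.
have a_gt0 : 0 < a by rewrite divn_gt0 ?addn1.
have a_lt : a < b by rewrite ltn_divLR ?addn1 // mulnS -expnS; lia.
exists a, x; split; first by split=> //; rewrite addn1 ltnS in x_lt.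
have x_le : x <= b ^ k by rewrite addn1 ltnS in x_lt.
have Frec := @F_rec b b_gt1 k a x a_gt0 a_lt x_le; rewrite -uE in Frec.
move: (Frec u_le); case: (leqP (x + 2) (k * b.-1)) => [x_small|_]; last by rewrite addn0 => ->; left.
set y := _ - x => FuE; case: (posnP (F b y)) => [y0|y_gt0]; first by left; rewrite FuE y0 addn0.
right; exists y; first by rewrite /y; lia.
case: (posnP (F b x)) => [x0|x_gt0]; first by left; rewrite FuE x0.
by right; split=> //; rewrite /y; lia.
Qed.

Lemma F_ge2_exponent n k0 : 1 < n -> (forall k, splits n k -> k0 <= k) ->
  forall u, F b u = n -> b ^ k0 < u.
Proof.
move=> n_gt1 k0_min; elim/ltn_ind => u IH Fu; have b_gt1 := b_gt1.
have u_gt1 : 1 < u.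
  case: u Fu {IH} => [|[|//]] Fu; move: n_gt1; rewrite -Fu ?F0 //.
  rewrite /F /generators /= /f /digit_sum big_ord0 big_ord_recl big_ord0 /=.
  by rewrite expn0 divn1 modn_small.
have u1_gt0 : 0 < u.-1 by lia.
(* The logarithm is that of [u - 1], so that [b ^ k < u <= b ^ k.+1] also when [u] is a power of
   [b]. *)
have /= := trunc_log_bounds b_gt1 u1_gt0; set k := trunc_log b _ => /andP[k_le k_lt].
case: (@F_decomp k u); rewrite ?Fu //; [lia|lia|].
move=> a [x [[uE a_gt0 x_le] [Fx|[y y_lt [Fy|[Fxy Fx Fy xy]]]]]].
- have : b ^ k + 1 <= a * (b ^ k + 1) by rewrite leq_pmull.
  by have := IH x _ Fx; lia.
- by have := IH y _ Fy; lia.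
- have : b ^ k0 <= b ^ k by rewrite leq_exp2l // k0_min //; exists x, y; split.
  lia.
Qed.

Lemma solve_residue c d : exists2 a, 0 < a <= N & a + d = c %[mod N].
Proof.
have N_gt0 := N_gt0; set r := (c + (N - d %% N)) %% N.
have r_lt : r < N by rewrite ltn_mod.
have d_lt : d %% N < N by rewrite ltn_mod.
have rc : r + d = c %[mod N].
  by rewrite modnDml -modnDmr -addnA subnK ?modnDr //; apply: ltnW.
case: (posnP r) => [r0|r_gt0]; last first.
  by exists r => //; rewrite r_gt0 /=; apply: ltnW.
(* The class of 0 is represented by [N], since [a] ranges over [1, ..., N]. *)
by exists N; rewrite ?N_gt0 ?leqnn // modnDl -rc r0.
Qed.

Lemma top_mod a k x d : x = 2 * d %[mod b.-1] ->
  a * (b ^ k + 1) + x = 2 * (a + d) %[mod b.-1].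
Proof.
move=> xd; rewrite (_ : a * _ = 2 * a + a * (b ^ k - 1)); last first.
  have bk_gt0 : 0 < b ^ k by rewrite expn_gt0 (ltnW b_gt1).
  have := leq_pmulr a bk_gt0; rewrite mulnDr mulnBr !muln1; clear; lia.
have /dvdnP[q ->] : b.-1 %| b ^ k - 1 by rewrite subn1 dvdn_pred_predX.
by rewrite mulnA addnAC addnC modnMDl -modnDmr xd modnDmr mulnDr.
Qed.

(** Pairs 0, which has one generator, with a number of the complementary class that has [n - 1]
    generators. *)
Lemma splits_exists n : 1 < n -> (forall c, exists2 u, F b u = n.-1 & u = 2 * c %[mod b.-1]) ->
  exists k, splits n k.
Proof.
move=> n_gt1 /(_ N.-1)[y Fy ry].
have /dvdnP[k yk] : b.-1 %| 0 + y + 2.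
  by rewrite (@complement_mod 0 y 0 N.-1) ?mod0n // add0n addn1 prednK ?N_gt0.
by exists k, 0, y; rewrite F0 Fy; split=> //; lia.
Qed.

Lemma splits_build n k c : splits n k -> exists a x,
  [/\ 0 < a <= N, x < b ^ k, F b (a * (b ^ k + 1) + x) = n,
      a * (b ^ k + 1) + x = 2 * c %[mod b.-1] & a * (b ^ k + 1) + x < b ^ k.+1].
Proof.
case=> x [y [<- Fx Fy xy]]; have [d xd] := F_gt0_mod Fx.
have [a aN ad] := solve_residue c d; exists a, x.
have [FE lt] := F_build aN Fx Fy xy; have bern := expn_bernoulli b_gt1 k.
split=> //; first by clear -xy bern; lia.
by rewrite (top_mod _ _ xd); apply/doubleP.
Qed.

Lemma Kc_exists n c : 0 < n -> exists2 u, F b u = n & u = 2 * c %[mod b.-1].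
Proof.
elim: n c => // -[_ c _|n IH c _].
  by exists (2 * (c %% N)); rewrite ?F_double ?ltn_mod ?N_gt0 //; apply/doubleP; rewrite modn_mod.
have [k /(splits_build c)[a [x [_ _ Fu ru _]]]] := @splits_exists n.+2 isT (fun c => IH c isT).
by exists (a * (b ^ k + 1) + x).
Qed.

End Exponents.

(** * The recursion for K *)

(* The class of [- 1 - d] modulo [N]. *)
Definition conj (N d : nat) : nat := N.-1 * d.+1.

Section Recursion.

Variables b N : nat.
Hypothesis bN : residue_count b N.

Notation Kc c n := (Kres b (2 * c) n).

Let b_gt1 := b_gt1 bN.
Let N_gt0 := N_gt0 bN.

Lemma F_Kc c n : 0 < n -> F b (Kc c n) = n.
Proof. by move=> n_gt0; case: (KcP (Kc_exists bN c n_gt0)). Qed.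

Lemma Kc_res c n : 0 < n -> Kc c n = 2 * c %[mod b.-1].
Proof. by move=> n_gt0; case: (KcP (Kc_exists bN c n_gt0)). Qed.

Lemma Kc_le c n u : 0 < n -> F b u = n -> u = 2 * c %[mod b.-1] -> Kc c n <= u.
Proof. by move=> n_gt0; case: (KcP (Kc_exists bN c n_gt0)) => _ _; apply. Qed.

Lemma conjE d : d + conj N d + 1 = d.+1 * N.
Proof. by rewrite /conj mulnC -{2}(prednK N_gt0) mulnS; lia. Qed.

Lemma conj_mod d e : (N %| d + e + 1) -> e = conj N d %[mod N].
Proof.
have : N %| d + conj N d + 1 by rewrite conjE dvdn_mull.
rewrite !(addnAC d _ 1) => h1 h2; apply/eqP.
by rewrite -(eqn_modDl (d + 1)); move: h1 h2; rewrite /dvdn => /eqP-> /eqP->.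
Qed.

(** If [M] is the least split exponent, every [u] with [F b u = n] exceeds [b ^ M], and
    [splits_build] yields one below [b ^ M.+1]; hence the logarithm of [K b n] is [M]. *)
Lemma B_spec n : 1 < n ->
  [/\ splits b n (B b n), forall k, splits b n k -> B b n <= k &
      forall u, F b u = n -> b ^ B b n < u].
Proof.
move=> n_gt1; have n1 : 0 < n.-1 by lia.
have ex : exists k, `[< splits b n k >].
  have [k sk] := splits_exists bN n_gt1 (fun c => Kc_exists bN c n1).
  by exists k; apply/asboolP.
case: (ex_minnP ex) => M /asboolP sM M_min.
have {}M_min k : splits b n k -> M <= k by move=> sk; apply/M_min/asboolP.
have lb := F_ge2_exponent bN n_gt1 M_min.
suff -> : B b n = M by [].
have [a [x [aN xM Fu _ u_lt]]] := splits_build bN 0 sM.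
have [|/eqP FK K_min] := @leastP (fun u => F b u == n).
  by exists (a * (b ^ M + 1) + x); rewrite Fu.
apply: trunc_log_eq => //; rewrite ltnW ?lb //=.
by apply: leq_ltn_trans u_lt; apply: K_min; rewrite Fu.
Qed.

Lemma calB_le c n : 1 < n -> calB b n <= Kc c n.
Proof.
move=> n_gt1; rewrite /calB addn1; case: (B_spec n_gt1) => _ _; apply.
by rewrite F_Kc // ltnW.
Qed.

(** The two minima lie in complementary classes, so they split [n] at some exponent, which is at
    least [B b n]. *)
Lemma split_ge n e q : 0 < q < n ->
  B b n * b.-1 <= Kc e q + Kc (conj N e) (n - q) + 2.
Proof.
case/andP=> q_gt0 q_lt; have nq : 0 < n - q by lia.
have n_gt1 : 1 < n by lia.
have := dvdn_mull e.+1 (dvdnn N); rewrite -conjE.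
rewrite -(complement_mod bN (Kc_res e q_gt0) (Kc_res (conj N e) nq)) => /dvdnP[k kE].
case: (B_spec n_gt1) => _ /(_ k) B_min _; rewrite kE leq_mul2r B_min ?orbT //.
by exists (Kc e q), (Kc (conj N e) (n - q)); rewrite !F_Kc //; split=> //; lia.
Qed.

(** The equality case of [split_ge]. *)
Definition admissible n d p :=
  0 < p < n /\ Kc d p + Kc (conj N d) (n - p) + 2 = B b n * b.-1.

Lemma admissible_small n d p : admissible n d p -> Kc d p < calB b n.
Proof.
case=> _ h; have := expn_bernoulli b_gt1 (B b n).
by rewrite -h /calB; lia.
Qed.

Lemma Kc_le_admissible c n a d p : 0 < a <= N -> a + d = c %[mod N] ->
  admissible n d p -> Kc c n <= a * calB b n + Kc d p.
Proof.
move=> aN ad [/andP[p_gt0 p_lt] h]; have np : 0 < n - p by lia.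
have Fp := F_Kc d p_gt0; have Fnp := F_Kc (conj N d) np.
apply: Kc_le; first lia.
  case: (F_build bN aN _ _ h); rewrite ?Fp ?Fnp //.
  by rewrite /calB => -> _; clear -p_lt; lia.
by rewrite /calB (top_mod bN _ _ (Kc_res d p_gt0)); apply/(doubleP bN).
Qed.

(** Decompose the minimum itself. A degenerate decomposition contradicts [b ^ B b n < u]; in a
    genuine one [x + y] is least possible by [split_ge], so [x] and [y] are each least for their
    count and class. *)
Lemma Kc_rec c n : 1 < n -> exists a d p,
  [/\ 0 < a <= N, d < N, a + d = c %[mod N], admissible n d p &
      Kc c n = a * calB b n + Kc d p].
Proof.
move=> n_gt1; have n_gt0 := ltnW n_gt1.
have [sM M_min lb] := B_spec n_gt1; set M := B b n in sM M_min lb.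
have Fu := F_Kc c n_gt0; have ru := Kc_res c n_gt0.
have [a0 [x0 [a0N x0M Fu0 ru0 u_lt0]]] := splits_build bN c sM.
have u_le := Kc_le n_gt0 Fu0 ru0.
have u_gt : b ^ M < Kc c n by apply: lb.
have u_lt : Kc c n <= b ^ M.+1 by apply: ltnW; apply: leq_ltn_trans u_lt0.
have F_gt1 : 1 < F b (Kc c n) by rewrite Fu.
case: (F_decomp bN u_gt u_lt F_gt1) => a [x [[uE a_gt0 x_le]]].
rewrite Fu => -[Fx|[y y_lt [Fy|[Fxy Fx Fy xy]]]].
- by move: (lb x Fx); rewrite ltnNge x_le.
- by move: (lb y Fy); rewrite ltnNge (ltnW y_lt).
have [d0 xd0] := F_gt0_mod bN Fx.
pose d := d0 %% N; have d_lt : d < N by rewrite ltn_mod.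
have xd : x = 2 * d %[mod b.-1] by rewrite xd0; apply/(doubleP bN); rewrite modn_mod.
have [e0 ye0] := F_gt0_mod bN Fy.
have : b.-1 %| x + y + 2 by rewrite xy dvdn_mull.
rewrite (complement_mod bN xd ye0) => /conj_mod/(doubleP bN) e0d; rewrite e0d in ye0.
have Fy' : F b y = n - F b x by rewrite -Fxy addKn.
have le1 := Kc_le Fx erefl xd; have le2 := Kc_le Fy erefl ye0.
rewrite Fy' in le2.
have pn : 0 < F b x < n by rewrite Fx -Fxy -[X in X < _]addn0 ltn_add2l.
have ge := split_ge d pn; rewrite -/M -xy in ge.
have xE : x = Kc d (F b x) by clear -ge le1 le2; lia.
exists a, d, (F b x); split=> //.
(* For [a > N] the competitor with [a0 <= N] and [x0 < b ^ M] would be smaller. *)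
- rewrite a_gt0 /= leqNgt; apply/negP => aN.
  have : N.+1 * (b ^ M + 1) <= a * (b ^ M + 1) by rewrite leq_mul2r aN orbT.
  have : a0 * (b ^ M + 1) <= N * (b ^ M + 1).
    by rewrite leq_mul2r; case/andP: a0N => _ ->; rewrite orbT.
  by clear -u_le uE x0M; rewrite mulSn; lia.
- by apply/(doubleP bN); rewrite -ru uE (top_mod bN _ _ xd).
- by split=> //; rewrite -/M -xy; clear -ge le1 le2; lia.
- by rewrite /calB -/M -xE.
Qed.

End Recursion.

(** * Growth of K *)

Lemma mod_pred_gt0 N e : 0 < N -> 0 < e %% N -> (e + N.-1) %% N = (e %% N).-1.
Proof.
case: N => // N _ e_gt0; have e_lt : e %% N.+1 < N.+1 by rewrite ltn_mod.
rewrite -modnDml /= (_ : _ + N = (e %% N.+1).-1 + N.+1).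
  by rewrite modnDr modn_small //; case: (e %% N.+1) e_lt => // r; apply: ltnW.
by move: e_gt0; clear; case: (e %% N.+1) => // r _; rewrite addSnnS.
Qed.

Lemma mod_pred_eq0 N e : 0 < N -> e %% N = 0 -> (e + N.-1) %% N = N.-1.
Proof. by move=> N_gt0 e0; rewrite -modnDml e0 modn_small // prednK. Qed.

Lemma mod_pred_ge N e : 0 < N -> e %% N <= ((e + N.-1) %% N).+1.
Proof.
move=> N_gt0; case: (posnP (e %% N)) => [->//|e_gt0].
by rewrite mod_pred_gt0 // prednK.
Qed.

Section Growth.

Variables b N : nat.
Hypothesis bN : residue_count b N.

Notation Kc c n := (Kres b (2 * c) n).
Notation pr c := ((c + N.-1) %% N).

Let b_gt1 := b_gt1 bN.
Let N_gt0 := N_gt0 bN.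

Lemma conj_modE d : d %% N + conj N d %% N + 1 = N.
Proof.
have : N %| d %% N + conj N d %% N + 1.
  by rewrite /dvdn -modnDml modnDm modnDml (conjE bN) modnMl.
have : d %% N < N by rewrite ltn_mod.
have : conj N d %% N < N by rewrite ltn_mod.
move: (d %% N) (conj N d %% N) => r r' r'_lt r_lt /dvdnP[[|[|q]] qE]; first lia.
  by rewrite qE mul1n.
by move: qE; clear -r_lt r'_lt; rewrite !mulSn; lia.
Qed.

Lemma B_ge n : 1 < n -> 2 * N <= B b n * b.-1.
Proof.
move=> n_gt1; case: (B_spec bN n_gt1) => [[x [y [_ Fx Fy xy]]] _ _].
by rewrite -xy (complement_ge bN) // xy dvdn_mull.
Qed.

Lemma calB_ge n : 1 < n -> 2 * N + 2 <= calB b n.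
Proof.
move=> /B_ge; have := expn_bernoulli b_gt1 (B b n); rewrite /calB; clear; lia.
Qed.

(** An admissible pair usable with [a = 1] forces the coefficient 1, since its remainder is below
    [calB b n]; the class [d] is then determined, and only the count may differ. *)
Lemma Kc_rec_first c n d p : admissible b N n d p -> d < N -> 1 + d = c %[mod N] ->
  exists q, [/\ admissible b N n d q, Kc c n = calB b n + Kc d q & Kc d q <= Kc d p].
Proof.
move=> adm d_lt dc; have n_gt1 : 1 < n by case: adm => /andP[? ?] _; lia.
have lt := admissible_small bN adm.
have := Kc_le_admissible bN (_ : 0 < 1 <= N) dc adm; rewrite N_gt0 => /(_ isT) le.
have [a [d' [p' [/andP[a_gt0 aN] d'_lt ad' adm' E]]]] := Kc_rec bN c n_gt1.
have a1 : a = 1.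
  apply/eqP; rewrite eqn_leq a_gt0 andbT leqNgt; apply/negP => a2.
  have : 2 * calB b n <= a * calB b n by rewrite leq_mul2r a2 orbT.
  by clear -le E lt; lia.
have dd' : d' = d.
  rewrite -(modn_small d_lt) -(modn_small d'_lt); apply/eqP.
  by rewrite -(eqn_modDl 1) dc -ad' a1.
exists p'; rewrite -dd'; split=> //; first by rewrite E a1 mul1n.
by rewrite dd'; clear -le E a1 dd'; rewrite a1 dd' in E; lia.
Qed.

(** The only count is [p = 1], and the sum of the two values is [2 * N.-1] for every class. *)
Lemma admissible2 d : admissible b N 2 d 1.
Proof.
have [a [d' [p' [_ _ _ [/andP[p0 p2] E] _]]]] := Kc_rec bN 0 (isT : 1 < 2).
split=> //; rewrite -E (_ : p' = 1) ?(Kc1 bN); last by clear -p0 p2; lia.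
have := conj_modE d; have := conj_modE d'.
by move: (d %% N) (conj N d %% N) (d' %% N) (conj N d' %% N); clear; lia.
Qed.

Lemma pr_mod c : 1 + pr c = c %[mod N].
Proof. by rewrite modnDmr addnCA add1n prednK // modnDr. Qed.

Lemma pr_lt c : pr c < N.
Proof. by rewrite ltn_mod. Qed.

Lemma Kc2 c : Kc c 2 = calB b 2 + 2 * pr c.
Proof.
have [q [[/andP[q0 q2] _] -> _]] := Kc_rec_first (admissible2 _) (pr_lt c) (pr_mod c).
have -> : q = 1 by clear -q0 q2; lia.
by rewrite (Kc1 bN) modn_mod.
Qed.

(** The least sum of values for the counts 1 and 2 is attained with the class 0 for count 1. For
    [N = 1] the truncated [N - 2] is 0, which is the right value. *)
Lemma B3 : B b 3 * b.-1 = calB b 2 + 2 * (N - 2) + 2.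
Proof.
apply/eqP; rewrite eqn_leq; apply/andP; split.
  have := split_ge bN 0 (isT : 0 < 1 < 3).
  rewrite (Kc1 bN) Kc2 mod0n muln0 add0n.
  suff -> : pr (conj N 0) = N - 2 by [].
  case: (posnP (conj N 0 %% N)) (conj_modE 0) => [c0|c_gt0].
    by rewrite (mod_pred_eq0 N_gt0) // mod0n c0 => <-.
  by rewrite mod_pred_gt0 // mod0n add0n; move: (conj N 0 %% N); clear; lia.
have [a [d [p [_ _ _ [/andP[p0 p3] <-] _]]]] := Kc_rec bN 0 (isT : 1 < 3).
have [->|->] : p = 1 \/ p = 2 by clear -p0 p3; lia.
  rewrite (Kc1 bN) Kc2; have := mod_pred_ge (conj N d) N_gt0; have := conj_modE d.
  by move: (d %% N) (conj N d %% N) (pr (conj N d)) (calB b 2); clear; lia.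
rewrite (Kc1 bN) Kc2; have := mod_pred_ge d N_gt0; have := conj_modE d.
by move: (d %% N) (conj N d %% N) (pr d) (calB b 2); clear; lia.
Qed.

(** The class [pr c] is paired with its conjugate, and [p = 1] is normally admissible. For [c = 0]
    and [1 < N] that conjugate is 0, whose predecessor wraps round to [N - 1]; then [p = 1] fails
    and [p = 2] takes over. *)
Lemma Kc3 c : Kc c 3 =
  calB b 3 + 2 * pr c + (if (c %% N == 0) && (1 < N) then calB b 2 - 2 else 0).
Proof.
have cB := calB_ge (isT : 1 < 2).
case: ifP => [/andP[/eqP c0 N_gt1]|cN].
  have dE : pr c = N.-1 by apply: mod_pred_eq0.
  have prd : pr N.-1 = N - 2.
    have N1 : N.-1 %% N = N.-1 by rewrite modn_small // prednK.
    by rewrite mod_pred_gt0 ?N1 //; clear -N_gt1; lia.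
  have cd : conj N N.-1 %% N = 0.
    by have := conj_modE N.-1; rewrite modn_small ?prednK //; clear -N_gt1; lia.
  have adm : admissible b N 3 N.-1 2.
    by split=> //; rewrite (Kc1 bN) Kc2 B3 prd cd; clear; lia.
  have := pr_mod c; rewrite dE => pm.
  have [|q [[/andP[q0 q3] qE] -> le]] := Kc_rec_first adm _ pm; first by rewrite prednK.
  have [q1|->] : q = 1 \/ q = 2 by clear -q0 q3; lia.
    move: qE; rewrite q1 (Kc1 bN) Kc2 B3 modn_small ?prednK //.
    by rewrite (mod_pred_eq0 N_gt0 cd); clear -N_gt1; lia.
  by rewrite Kc2 prd; clear -N_gt1 cB; lia.
have adm : admissible b N 3 (pr c) 1.
  split=> //; rewrite (Kc1 bN) Kc2 B3 modn_mod.
  have := conj_modE (pr c); rewrite modn_mod.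
  case: (leqP N 1) => N1.
    have -> : N = 1 by apply/eqP; rewrite eqn_leq N1 N_gt0.
    by rewrite !modn1.
  have c_gt0 : 0 < c %% N by rewrite lt0n; move: cN; rewrite N1 andbT => ->.
  have c_lt : c %% N < N by rewrite ltn_mod.
  rewrite (mod_pred_gt0 N_gt0 c_gt0) => conjc.
  rewrite mod_pred_gt0 //; move: (c %% N) (conj N (pr c) %% N) conjc c_gt0 c_lt => r r'.
    by clear -N1; lia.
  by clear -N1; lia.
have [q [[/andP[q0 q3] qE] -> le]] := Kc_rec_first adm (pr_lt c) (pr_mod c).
have [->|q2] : q = 1 \/ q = 2 by clear -q0 q3; lia.
  by rewrite (Kc1 bN) modn_mod addn0.
move: le; rewrite q2 (Kc1 bN) Kc2 modn_mod.
by have := pr_lt c; move: (pr c) (calB b 2) cB; clear; lia.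
Qed.

Definition doubling r := forall c, 2 * Kc c r < calB b r.+1.

(** Doubling is a hypothesis because this gap enters, through [B_gap], the induction that proves
    [doublingP]. *)
Lemma Kc_succ_ge r : 1 < r -> (2 < r -> doubling r.-1) ->
  forall e, Kc e r.-1 + 2 * N <= Kc e r.
Proof.
move=> r_gt1 h e; case: (leqP r 2) => r2.
  have -> : r = 2 by clear -r2 r_gt1; lia.
  rewrite (Kc1 bN) Kc2; have := calB_ge (isT : 1 < 2); have := mod_pred_ge e N_gt0.
  by move: (e %% N) (pr e) (calB b 2); clear; lia.
have r1 : 1 < r.-1 by clear -r2; lia.
have := h r2 e; have := calB_le bN e r1; have := calB_le bN e r_gt1; have := calB_ge r1.
by rewrite prednK; [clear; lia | clear -r_gt1; lia].
Qed.

(** Lowering one count of an admissible pair for [r + 1] gives a pair for [r] and reduces the sum by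
    at least [2 * N]. *)
Lemma B_gap r : 1 < r -> (forall s, 1 < s < r -> doubling s) ->
  B b r * b.-1 + 2 * N <= B b r.+1 * b.-1.
Proof.
move=> r_gt1 IH.
have succ s : 1 < s <= r -> forall e, Kc e s.-1 + 2 * N <= Kc e s.
  move=> sr; apply: Kc_succ_ge; first by case/andP: sr.
  by move=> s2; apply: IH; clear -sr s2; lia.
have [a [d [p [_ _ _ [/andP[p0 pr] <-] _]]]] := Kc_rec bN 0 (ltnW r_gt1 : 1 < r.+1).
case: (ltnP p r) => p_lt.
  have := split_ge bN d (_ : 0 < p < r); rewrite p0 p_lt => /(_ isT).
  have := succ (r.+1 - p) _ (conj N d); rewrite subSn //=.
  have -> : 1 < (r - p).+1 <= r by clear -p0 p_lt; lia.
  by move=> /(_ isT); clear; lia.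
(* For [p = r] the second count is 1 and cannot be lowered, so the first one is. *)
have {p_lt pr}-> : p = r by apply/eqP; rewrite eqn_leq -ltnS pr.
have := split_ge bN d (_ : 0 < r.-1 < r).
have -> : 0 < r.-1 < r by clear -r_gt1; lia.
have -> : r - r.-1 = 1 by clear -r_gt1; lia.
have := succ r _ d; rewrite r_gt1 leqnn subSnn => /(_ isT) + /(_ isT).
by clear; lia.
Qed.

(** The slack 5 is what [doublingP] offers in base [2 * N + 1]: 4 from doubling the bound
    [x + 2 <= k * b.-1], and 1 from [calB]. *)
Lemma bernoulli_double k : 2 < b -> 2 <= k -> (2 * k).+1 * b.-1 < b ^ k + 5.
Proof.
move=> b_gt2; elim: k => // k IH; rewrite leq_eqVlt => /orP[/eqP <-|k_ge].
  by rewrite -(prednK (ltnW b_gt1)) /=; move: b.-1 => c; nia.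
have := IH k_ge; rewrite (expnS_pred b_gt1).
have : b.-1 * 2 <= b.-1 * b ^ k.
  rewrite leq_mul2l; apply/orP; right.
  by apply: leq_trans (ltn_expl k b_gt1); apply: leqW.
rewrite (_ : (2 * k.+1).+1 = (2 * k).+1 + 2) ?mulnDl; last by clear; lia.
by move: (b.-1 * b ^ k) => X; clear; lia.
Qed.

(** By [Kc_rec] the value is at most [N * calB b r + B b r * b.-1 - 2], while by [B_gap] the
    exponent grows by at least 2 if [b = N + 1] and by at least 1 if [b = 2 * N + 1]. *)
Lemma doublingP r : 1 < r -> doubling r.
Proof.
elim/ltn_ind: r => r IH r_gt1 c.
have {}IH s : 1 < s < r -> doubling s by case/andP => s1 sr; apply: IH.
have gap := B_gap r_gt1 IH; have M_ge := B_ge r_gt1.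
have [a [d [p [/andP[_ aN] _ _ [_ adm] E]]]] := Kc_rec bN c r_gt1.
have {adm} x_le : Kc d p + 2 <= B b r * b.-1 by rewrite -adm; clear; lia.
have aB : a * calB b r <= N * calB b r by rewrite leq_mul2r aN orbT.
case: (bN) => _ [[bE _]|bE].
  have bp : b.-1 = N by rewrite bE.
  move: gap M_ge x_le; rewrite bp -mulnDl !leq_mul2r ![N == 0]eqn0Ngt N_gt0 /=.
  move=> gap M_ge x_le; have := expn_bernoulli2 bN M_ge; rewrite bp => bern.
  have : b ^ (B b r + 2) <= b ^ B b r.+1 by rewrite leq_exp2l.
  rewrite addn2 expnS (expnS_pred b_gt1) bp => le.
  have : 2 * (b ^ B b r + N * b ^ B b r) <= b * (b ^ B b r + N * b ^ B b r).
    by rewrite leq_mul2r b_gt1 orbT.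
  move: aB E; rewrite /calB => aB E.
  by clear -aB E le bern x_le; rewrite mulSn mulnDr in bern aB *; lia.
have bp : b.-1 = 2 * N by rewrite bE mul2n.
have N2 : 0 < 2 * N by rewrite muln_gt0.
have b_gt2 : 2 < b by rewrite bE ltnS; have := N_gt0; clear; lia.
have gap1 : (B b r).+1 <= B b r.+1.
  by move: gap; rewrite bp -{2}(mul1n (2 * N)) -mulnDl leq_mul2r eqn0Ngt N2 addn1.
have := leq_pexp2l (ltnW b_gt1) gap1; rewrite (expnS_pred b_gt1) bp => le.
have M1 : 1 <= B b r.
  by move: M_ge; rewrite bp -{1}(mul1n (2 * N)) leq_mul2r eqn0Ngt N2.
case: (ltnP 1 (B b r)) => M2.
  have := bernoulli_double b_gt2 M2; rewrite bp => bern.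
  move: aB E; rewrite /calB => aB E.
  clear -aB E le bern x_le bp; rewrite mulSn in bern; rewrite mulnDr in aB.
  by rewrite bp in x_le; nia.
(* The exponent 1 is out of reach of [bernoulli_double]; by [B_gap] it occurs only for [r = 2],
   where [Kc2] gives the exact value. *)
have r2 : r = 2.
  apply/eqP; rewrite eqn_leq r_gt1 andbT leqNgt; apply/negP => r_gt2.
  have r1 : 1 < r.-1 by clear -r_gt2; lia.
  have := @B_gap r.-1 r1; rewrite prednK ?(ltnW r_gt1) // => g.
  have {}g := g (fun s sr => IH s ltac:(clear -sr; lia)).
  have := B_ge r1; move: g; have : B b r = 1 by apply/eqP; rewrite eqn_leq M2 M1.
  by move=> ->; rewrite bp; clear -N2; lia.
have B1 : B b r = 1 by apply/eqP; rewrite eqn_leq M2 M1.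
rewrite B1 expn1 in le.
rewrite r2 in B1 le *; rewrite Kc2 /calB B1 expn1.
have := pr_lt c; rewrite bE in le *; clear -le N_gt0; move: (pr c) => v v_lt.
nia.
Qed.

Lemma Kc_succ e r : 0 < r -> Kc e r < Kc e r.+1.
Proof.
move=> r_gt0; have := @Kc_succ_ge r.+1 r_gt0 (fun r2 => doublingP r2) e.
by have := N_gt0; clear; rewrite /=; lia.
Qed.

Lemma Kc_mono e p q : 0 < p <= q -> Kc e p <= Kc e q.
Proof.
case/andP=> p_gt0; elim: q => [|q IH]; first by rewrite leqn0 => /eqP->.
rewrite leq_eqVlt => /orP[/eqP->//|pq]; apply: leq_trans (IH pq) _.
by apply/ltnW/Kc_succ; apply: leq_trans p_gt0 pq.
Qed.

Lemma Kc_lt e p q : 0 < p < q -> Kc e p < Kc e q.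
Proof.
by case/andP=> p0 pq; apply: leq_trans (Kc_succ e p0) _; apply: Kc_mono.
Qed.

Lemma Kc_double_lt e p q : 0 < p < q -> 2 < q -> 2 * Kc e p < calB b q.
Proof.
case: q => // q /andP[p0 pq] q2; apply: leq_ltn_trans (doublingP q2 e).
by rewrite leq_mul2l Kc_mono // p0.
Qed.

Lemma calB_lt n : 1 < n -> calB b n < calB b n.+1.
Proof.
move=> n_gt1; have := doublingP n_gt1 0; have := calB_le bN 0 n_gt1; clear; lia.
Qed.

Lemma calB_mono p q : 1 < p <= q -> calB b p <= calB b q.
Proof.
case/andP=> p_gt1; elim: q => [|q IH]; first by rewrite leqn0 => /eqP->.
rewrite leq_eqVlt => /orP[/eqP->//|pq]; apply: leq_trans (IH pq) _.
by apply/ltnW/calB_lt/(leq_trans p_gt1 pq).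
Qed.

Lemma calB_succ_ge n : 1 < n -> N.+1 * calB b n <= calB b n.+1.
Proof.
move=> n_gt1; have gap := B_gap n_gt1 (fun s sr => doublingP (proj1 (andP sr))).
have X_gt0 : 0 < b ^ B b n by rewrite expn_gt0 ltnW.
have NX : N <= N * b ^ B b n by rewrite leq_pmulr.
rewrite /calB mulSn mulnDr; case: (bN) => _ [[bE _]|bE].
  have bp : b.-1 = N by rewrite bE.
  move: gap; rewrite bp -mulnDl leq_mul2r eqn0Ngt N_gt0 /= => gap.
  have : b ^ (B b n + 2) <= b ^ B b n.+1 by rewrite leq_exp2l.
  rewrite addn2 expnS (expnS_pred b_gt1) bp => le.
  have : 2 * (b ^ B b n + N * b ^ B b n) <= b * (b ^ B b n + N * b ^ B b n).
    by rewrite leq_mul2r b_gt1 orbT.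
  by clear -le NX X_gt0; lia.
have bp : b.-1 = 2 * N by rewrite bE mul2n.
have gap1 : (B b n).+1 <= B b n.+1.
  move: gap; rewrite bp -{2}(mul1n (2 * N)) -mulnDl leq_mul2r eqn0Ngt muln_gt0 N_gt0.
  by rewrite addn1.
have := leq_pexp2l (ltnW b_gt1) gap1; rewrite (expnS_pred b_gt1) bp -mulnA.
by clear -NX; lia.
Qed.

(** If the counts differ by 2 or more, moving one unit from the larger count [q] to the smaller
    gives two values each below half of [calB b q], hence a sum below the minimum. *)
Lemma admissible_half n d p : admissible b N n d p -> p = n./2 \/ p = uphalf n.
Proof.
case=> /andP[p0 pn] E.
case: (leqP (p + 2) (n - p)) => [le|gt].
  have := split_ge bN d (_ : 0 < p.+1 < n).
  have -> : 0 < p.+1 < n by clear -le; lia.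
  have := @Kc_double_lt d p.+1 (n - p); have := @Kc_double_lt (conj N d) (n - p.+1) (n - p).
  have := calB_le bN (conj N d) (_ : 1 < n - p).
  move=> /(_ ltac:(clear -le; lia)) h1 /(_ ltac:(clear -le; lia) ltac:(clear -le p0; lia)) h2.
  move=> /(_ ltac:(clear -le; lia) ltac:(clear -le p0; lia)) h3 /(_ isT) h4.
  by clear -h1 h2 h3 h4 E; lia.
case: (leqP (n - p + 2) p) => [le|gt'].
  have := split_ge bN d (_ : 0 < p.-1 < n).
  have -> : 0 < p.-1 < n by clear -le pn; lia.
  have -> : n - p.-1 = (n - p).+1 by clear -p0 pn; lia.
  have := @Kc_double_lt d p.-1 p; have := @Kc_double_lt (conj N d) (n - p).+1 p.
  have := calB_le bN d (_ : 1 < p).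
  move=> /(_ ltac:(clear -le; lia)) h1 /(_ ltac:(clear -le; lia) ltac:(clear -le pn; lia)) h2.
  move=> /(_ ltac:(clear -le pn; lia) ltac:(clear -le pn; lia)) h3 /(_ isT) h4.
  by clear -h1 h2 h3 h4 E; lia.
by clear -gt gt' pn; lia.
Qed.

End Growth.

(** * Comparison of two bases *)

Lemma leq_lex A A' x x' T : x < T -> x' < T ->
  (A * T + x <= A' * T + x') = (A < A') || (A == A') && (x <= x').
Proof.
move=> xT x'T; case: ltngtP => [lt|gt|->] /=; last by rewrite leq_add2l.
  have : A.+1 * T <= A' * T by rewrite leq_mul2r lt orbT.
  by rewrite mulSn; clear -xT; lia.
have : A'.+1 * T <= A * T by rewrite leq_mul2r gt orbT.
by rewrite mulSn; clear -x'T; lia.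
Qed.

Section TwoBases.

Variables b b' N : nat.
Hypotheses (bN : residue_count b N) (bN' : residue_count b' N).

Let N_gt0 := N_gt0 bN.

Definition half_of n p := p = n./2 \/ p = uphalf n.

Definition splits_agree n := forall d e p q, half_of n p -> half_of n q ->
  (Kres b (2 * d) p + Kres b (2 * conj N d) (n - p) <=
     Kres b (2 * e) q + Kres b (2 * conj N e) (n - q)) =
  (Kres b' (2 * d) p + Kres b' (2 * conj N d) (n - p) <=
     Kres b' (2 * e) q + Kres b' (2 * conj N e) (n - q)).

(** The form that survives the induction: once leading terms are removed, the remaining classes need
    not be conjugate, nor the counts have a fixed sum. *)
Definition pairs_agree g := forall c1 c2 e1 e2 p1 p2 q1 q2,
  g <= p1 <= g.+1 -> g <= p2 <= g.+1 -> g <= q1 <= g.+1 -> g <= q2 <= g.+1 ->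
  (Kres b (2 * c1) p1 + Kres b (2 * c2) p2 <=
     Kres b (2 * e1) q1 + Kres b (2 * e2) q2) =
  (Kres b' (2 * c1) p1 + Kres b' (2 * c2) p2 <=
     Kres b' (2 * e1) q1 + Kres b' (2 * e2) q2).

Lemma pairs_splits n : pairs_agree n./2 -> splits_agree n.
Proof.
move=> C d e p q; have nE := odd_double_half n; rewrite /half_of uphalf_half.
by move=> pn qn; apply: C; clear -nE pn qn; lia.
Qed.

Lemma splits_agree2 : splits_agree 2.
Proof.
by move=> d e p q [->|->] [->|->]; rewrite /= !(Kc1 bN) !(Kc1 bN').
Qed.

(** The counts are 1 and 2 in some order, so [calB c 2] occurs exactly once on each side and
    cancels. *)
Lemma splits_agree3 : splits_agree 3.
Proof.
move=> d e p q pn qn.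
suff red c : residue_count c N -> forall d p, half_of 3 p ->
    Kres c (2 * d) p + Kres c (2 * conj N d) (3 - p) = calB c 2 +
    (if p == 1 then 2 * (d %% N) + 2 * ((conj N d + N.-1) %% N)
     else 2 * ((d + N.-1) %% N) + 2 * (conj N d %% N)).
  by rewrite !(red b bN) // !(red b' bN') // !leq_add2l.
move=> cN {p q pn qn e}d' p [->|->] /=; rewrite (Kc1 cN) (Kc2 cN); first by rewrite addnCA.
by rewrite addnA.
Qed.

End TwoBases.

(** * Transfer of one step of the recursion *)

Definition step b N n c a d p :=
  [/\ 0 < a <= N, d < N, half_of n p,
      Kres b (2 * c) n = a * calB b n + Kres b (2 * d) p &
      Kres b (2 * d) p < calB b n].

(** Admissible pairs are the minimisers of the sum over all classes and the halves of [n], so the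
    order of these sums determines them. *)
Lemma admissible_transfer b b' N n d p :
  residue_count b N -> residue_count b' N -> splits_agree b b' N n ->
  admissible b N n d p -> admissible b' N n d p.
Proof.
move=> bN bN' agree adm; have [pn E] := adm.
have n_gt1 : 1 < n by clear -pn; lia.
have [a [e [q [_ _ _ adm' _]]]] := Kc_rec bN' 0 n_gt1.
have ph := admissible_half bN adm; have qh := admissible_half bN' adm'.
have [qn E'] := adm'; split=> //.
apply/eqP; rewrite eqn_leq (split_ge bN') // andbT -E' leq_add2r -agree //.
by rewrite -(leq_add2r 2) E (split_ge bN).
Qed.

Lemma splits_agree_sym b b' N n : splits_agree b b' N n -> splits_agree b' b N n.
Proof. by move=> h d e p q pn qn; rewrite h. Qed.

(** The choice made in each base is admissible in the other, hence a competitor there; the two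
    lexicographic comparisons force equal coefficients. *)
Lemma step_agree b b' N n c :
  residue_count b N -> residue_count b' N -> splits_agree b b' N n -> 1 < n ->
  exists a d p, step b N n c a d p /\ step b' N n c a d p.
Proof.
move=> bN bN' agree n_gt1.
have [a [d [p [aN dN adc adm E]]]] := Kc_rec bN c n_gt1.
have [a' [d' [p' [aN' dN' adc' adm' E']]]] := Kc_rec bN' c n_gt1.
have tadm := admissible_transfer bN bN' agree adm.
have tadm' := admissible_transfer bN' bN (splits_agree_sym agree) adm'.
have small := admissible_small bN adm; have tsmall' := admissible_small bN tadm'.
have small' := admissible_small bN' adm'; have tsmall := admissible_small bN' tadm.
have := Kc_le_admissible bN aN' adc' tadm'; rewrite E leq_lex // => le.
have := Kc_le_admissible bN' aN adc tadm; rewrite E' leq_lex // => le'.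
have aa' : a' = a by clear -le le'; lia.
have dd' : d' = d.
  rewrite -(modn_small dN) -(modn_small dN'); apply/eqP.
  by rewrite -(eqn_modDl a) adc -aa' adc'.
rewrite aa' dd' in le le' E' small' tsmall'.
move: le le'; rewrite ltnn eqxx /= => le le'.
(* With [a] and [d] equal, only the count is left, and [Kres] is strictly increasing in it in both
   bases. *)
have pp' : p' = p.
  have [/andP[p0 _] _] := adm; have [/andP[p0' _] _] := adm'.
  case: (ltngtP p p') => // lt; have lt2 := lt.
    have := Kc_lt bN' d (_ : 0 < p < p'); rewrite p0 lt => /(_ isT).
    by rewrite ltnNge le'.
  have := Kc_lt bN d (_ : 0 < p' < p); rewrite p0' lt => /(_ isT).
  by rewrite ltnNge le.
rewrite pp' in E'; exists a, d, p; split; split=> //; apply: (admissible_half bN adm).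
Qed.

(* The part of [Kres b (2 * c) p], for [p] in [2, 3, 4], below [calB b 3]: [eps] is
   [1] for [p = 3] and [c = 0], where (if [1 < N]) the last terms are
   [calB b 2 + 2 * (N - 2)] instead of [2 * (N - 1)]. *)
Definition low b k v eps := k * calB b 2 + 2 * v + eps * (calB b 2 - 2).

Definition low_ok N v eps := v < N /\ (eps = 0 \/ eps = 1 /\ v = N.-1).

(* In base [2 * N + 1], [calB b 2 = 2 * N + 2] is too small to dominate every sum
   [2 * V]; the comparison is lexicographic because [eps = 1] forces [v = N - 1]. *)
Lemma low_lex N Q V W E F : 2 * N <= Q -> V + 2 <= 2 * N -> W + 2 <= 2 * N ->
  E <= 2 -> F <= 2 -> E * N <= V + E -> F * N <= W + F ->
  (2 * V + E * Q <= 2 * W + F * Q) = (E < F) || (E == F) && (V <= W).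
Proof.
move=> NQ VN WN; case: E => [|[|[|//]]] _; case: F => [|[|[|//]]] _ EV FW;
  rewrite /= ?mul0n ?mul1n ?mul2n; lia.
Qed.

Lemma low_ok_add N v w e f : low_ok N v e -> low_ok N w f ->
  [/\ v + w + 2 <= 2 * N, e + f <= 2 & (e + f) * N <= v + w + (e + f)].
Proof.
by move=> [vN [->|[-> vE]]] [wN [->|[-> wE]]]; split=> //;
  rewrite ?mul0n ?mul1n ?(mul2n N) //; lia.
Qed.

(** The equal totals of [k] cancel, and [low_lex] decides the remaining comparison by a criterion
    free of the base. *)
Lemma low_agree b b' N k1 k2 l1 l2 v1 v2 w1 w2 e1 e2 f1 f2 :
  residue_count b N -> residue_count b' N -> k1 + k2 = l1 + l2 ->
  low_ok N v1 e1 -> low_ok N v2 e2 -> low_ok N w1 f1 -> low_ok N w2 f2 ->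
  (low b k1 v1 e1 + low b k2 v2 e2 <= low b l1 w1 f1 + low b l2 w2 f2) =
  (low b' k1 v1 e1 + low b' k2 v2 e2 <= low b' l1 w1 f1 + low b' l2 w2 f2).
Proof.
move=> bN bN' kl ok1 ok2 ok3 ok4.
have red c : low c k1 v1 e1 + low c k2 v2 e2 <= low c l1 w1 f1 + low c l2 w2 f2 =
   (2 * (v1 + v2) + (e1 + e2) * (calB c 2 - 2) <= 2 * (w1 + w2) + (f1 + f2) * (calB c 2 - 2)).
  rewrite -[RHS](leq_add2l ((k1 + k2) * calB c 2)) {2}kl /low !mulnDl !mulnDr.
  by congr (_ <= _); clear; lia.
have [VN E2 EV] := low_ok_add ok1 ok2; have [WN F2 FW] := low_ok_add ok3 ok4.
rewrite !red !(low_lex _ VN WN E2 F2 EV FW) //.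
  by have := calB_ge bN' (isT : 1 < 2); clear; lia.
by have := calB_ge bN (isT : 1 < 2); clear; lia.
Qed.

Lemma low_lt b N k v eps : residue_count b N -> k + eps <= 1 -> low_ok N v eps ->
  2 * low b k v eps < calB b 3.
Proof.
move=> bN ke [vN _]; have := Kc_double_lt bN 0 (isT : 0 < 2 < 3) isT.
rewrite (Kc2 bN) mod_pred_eq0 ?mod0n ?(N_gt0 bN) //.
have cB := calB_ge bN (isT : 1 < 2); rewrite /low.
case: k ke => [|[|k]] ke; last by [].
  by case: eps ke => [|[|//]] _; clear -vN cB; lia.
by have -> : eps = 0; clear -ke vN; lia.
Qed.

(** * Comparison of pairs by leading coefficients *)

Definition levels b g u A A' x :=
  [/\ u = A * calB b g.+1 + (A' * calB b g + x),
      2 * (A' * calB b g + x) < calB b g.+1 & 2 * x < calB b g].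

(** Bounding each remainder by half of its scale lets two values be added without a carry. *)
Lemma levels_le b g u1 u2 w1 w2 A1 A2 B1 B2 A1' A2' B1' B2' x1 x2 y1 y2 :
  levels b g u1 A1 A1' x1 -> levels b g u2 A2 A2' x2 ->
  levels b g w1 B1 B1' y1 -> levels b g w2 B2 B2' y2 ->
  (u1 + u2 <= w1 + w2) = (A1 + A2 < B1 + B2) || (A1 + A2 == B1 + B2) &&
    ((A1' + A2' < B1' + B2') || (A1' + A2' == B1' + B2') && (x1 + x2 <= y1 + y2)).
Proof.
move=> [-> lt1 lt1'] [-> lt2 lt2'] [-> lt3 lt3'] [-> lt4 lt4'].
have sum C1 C2 C1' C2' T T' z1 z2 : C1 * T + (C1' * T' + z1) + (C2 * T + (C2' * T' + z2)) =
    (C1 + C2) * T + ((C1' + C2') * T' + (z1 + z2)).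
  by rewrite !mulnDl; clear; lia.
rewrite !sum !leq_lex //; rewrite ?mulnDl; clear -lt1 lt1' lt2 lt2' lt3 lt3' lt4 lt4'; lia.
Qed.

(** Whether [p] is [g] or [g + 1] decides which scale [a] belongs to; [2 < g] puts the next count
    [q] below [g]. *)
Lemma step_levels b N g p c a d q : residue_count b N -> 2 < g -> g <= p <= g.+1 ->
  step b N p c a d q ->
  levels b g (Kres b (2 * c) p) (if p == g then 0 else a) (if p == g then a else 0)
    (Kres b (2 * d) q).
Proof.
move=> bN g_gt2 gp [_ _ qp E lt]; rewrite /levels.
have q_gt0 : 0 < q by case: qp => ->; clear -gp g_gt2; lia.
have q_lt : q < g by case: qp => ->; clear -gp g_gt2; lia.
have qg : 0 < q < g by rewrite q_gt0.
have qg1 : 0 < q < g.+1 by rewrite q_gt0 ltnW.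
have lt1 := Kc_double_lt bN d qg g_gt2.
have lt2 := Kc_double_lt bN d qg1 (ltnW g_gt2).
case: eqP => [pg|/eqP pg]; last first.
  have pE : p = g.+1 by clear -pg gp; lia.
  by rewrite mul0n add0n -pE in lt2 *.
rewrite pg in E *; rewrite mul0n add0n E; split=> //.
by rewrite -E; apply: (doublingP bN); apply: ltnW.
Qed.

(** The leading coefficients agree in both bases by [step_agree]; the remainders have counts [g./2]
    or [g./2.+1] and fall under the hypothesis for [g./2]. *)
Lemma pairs_agree_step b b' N g : residue_count b N -> residue_count b' N -> 2 < g ->
  splits_agree b b' N g -> splits_agree b b' N g.+1 -> pairs_agree b b' g./2 ->
  pairs_agree b b' g.
Proof.
move=> bN bN' g_gt2 agree agree1 C c1 c2 e1 e2 p1 p2 q1 q2 p1g p2g q1g q2g.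
have key c p : g <= p <= g.+1 -> exists A A' d q, g./2 <= q <= g./2.+1 /\
    levels b g (Kres b (2 * c) p) A A' (Kres b (2 * d) q) /\
    levels b' g (Kres b' (2 * c) p) A A' (Kres b' (2 * d) q).
  move=> pg; have p_gt1 : 1 < p by clear -pg g_gt2; lia.
  have agr : splits_agree b b' N p.
    by have [->//|->//] : p = g \/ p = g.+1; clear -pg; lia.
  have [a [d [q [st st']]]] := step_agree c bN bN' agr p_gt1.
  exists (if p == g then 0 else a), (if p == g then a else 0), d, q.
  split; last by split; [apply: step_levels st|apply: step_levels st'].
  by case: st => _ _ [->|->] _ _; clear -pg; lia.
have [? [? [? [? [? [l1 l1']]]]]] := key c1 p1 p1g.
have [? [? [? [? [? [l2 l2']]]]]] := key c2 p2 p2g.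
have [? [? [? [? [? [l3 l3']]]]]] := key e1 q1 q1g.
have [? [? [? [? [? [l4 l4']]]]]] := key e2 q2 q2g.
by rewrite (levels_le l1 l2 l3 l4) (levels_le l1' l2' l3' l4') C.
Qed.

Definition eps3 N c : nat := (c %% N == 0) && (1 < N).

Lemma eps3_ok N c : 0 < N -> low_ok N ((c + N.-1) %% N) (eps3 N c).
Proof.
move=> N_gt0; split; first by rewrite ltn_mod.
rewrite /eps3; case: eqP => [c0|_]; last by left.
by case: (1 < N); [right; rewrite mod_pred_eq0|left].
Qed.

Lemma Kc3_low b N c : residue_count b N ->
  Kres b (2 * c) 3 = calB b 3 + low b 0 ((c + N.-1) %% N) (eps3 N c).
Proof.
move=> bN; rewrite (Kc3 bN) /low /eps3 mul0n add0n -addnA.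
by case: ifP => _; rewrite ?mul1n ?mul0n.
Qed.

Lemma Kc2_low b N c : residue_count b N ->
  Kres b (2 * c) 2 = low b 1 ((c + N.-1) %% N) 0.
Proof. by move=> bN; rewrite (Kc2 bN) /low mul1n mul0n addn0. Qed.

Lemma eps0_ok N c : 0 < N -> low_ok N (c %% N) 0.
Proof. by move=> N_gt0; split; [rewrite ltn_mod|left]. Qed.

Lemma pairs_agree2 b b' N : residue_count b N -> residue_count b' N -> pairs_agree b b' 2.
Proof.
move=> bN bN' c1 c2 e1 e2 p1 p2 q1 q2 p1g p2g q1g q2g; have N0 := N_gt0 bN.
(* [A + k = 1] records that each value has one leading term, [calB b 3] or [calB b 2]; so equal sums
   of [A] give the equal sums of [k] that [low_agree] demands. *)
have key c p : 2 <= p <= 3 -> exists A k v eps, [/\ A + k = 1, k + eps <= 1, low_ok N v eps,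
    Kres b (2 * c) p = A * calB b 3 + low b k v eps &
    Kres b' (2 * c) p = A * calB b' 3 + low b' k v eps].
  move=> pg; have [->|->] : p = 2 \/ p = 3 by clear -pg; lia.
    exists 0, 1, ((c + N.-1) %% N), 0; rewrite (Kc2_low _ bN) (Kc2_low _ bN').
    by split=> //; apply: eps0_ok.
  exists 1, 0, ((c + N.-1) %% N), (eps3 N c); rewrite (Kc3_low _ bN) (Kc3_low _ bN') !mul1n.
  by split=> //; [apply: leq_b1|apply: eps3_ok].
have [A1 [k1 [v1 [s1 [Ak1 ks1 ok1 -> ->]]]]] := key c1 p1 p1g.
have [A2 [k2 [v2 [s2 [Ak2 ks2 ok2 -> ->]]]]] := key c2 p2 p2g.
have [A3 [k3 [v3 [s3 [Ak3 ks3 ok3 -> ->]]]]] := key e1 q1 q1g.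
have [A4 [k4 [v4 [s4 [Ak4 ks4 ok4 -> ->]]]]] := key e2 q2 q2g.
have lex c : residue_count c N ->
  (A1 * calB c 3 + low c k1 v1 s1 + (A2 * calB c 3 + low c k2 v2 s2) <=
   A3 * calB c 3 + low c k3 v3 s3 + (A4 * calB c 3 + low c k4 v4 s4)) =
  (A1 + A2 < A3 + A4) || (A1 + A2 == A3 + A4) &&
  (low c k1 v1 s1 + low c k2 v2 s2 <= low c k3 v3 s3 + low c k4 v4 s4).
  move=> cN; have lt1 := low_lt cN ks1 ok1; have lt2 := low_lt cN ks2 ok2.
  have lt3 := low_lt cN ks3 ok3; have lt4 := low_lt cN ks4 ok4.
  rewrite addnACA -mulnDl [X in _ <= X]addnACA -mulnDl leq_lex //.
    by clear -lt1 lt2; lia.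
  by clear -lt3 lt4; lia.
rewrite !lex //; case: eqP => // AE; congr (_ || _); rewrite /=.
by apply: (low_agree bN bN') => //; clear -AE Ak1 Ak2 Ak3 Ak4; lia.
Qed.

Lemma pairs_agree3 b b' N : residue_count b N -> residue_count b' N -> pairs_agree b b' 3.
Proof.
move=> bN bN' c1 c2 e1 e2 p1 p2 q1 q2 p1g p2g q1g q2g; have N0 := N_gt0 bN.
(* Again [A' + k = 1]: count 3 contributes [calB b 3], while count 4 halves into 2 and 2 and
   contributes [calB b 2] through its remainder. *)
have key c p : 3 <= p <= 4 -> exists A A' k v eps,
    [/\ A' + k = 1, low_ok N v eps, levels b 3 (Kres b (2 * c) p) A A' (low b k v eps) &
        levels b' 3 (Kres b' (2 * c) p) A A' (low b' k v eps)].
  move=> pg; have [->|->] : p = 3 \/ p = 4 by clear -pg; lia.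
    exists 0, 1, 0, ((c + N.-1) %% N), (eps3 N c).
    have ok := eps3_ok c N0; have ke : 0 + eps3 N c <= 1 by apply: leq_b1.
    split=> //.
      split; rewrite ?mul0n ?add0n ?mul1n -?(Kc3_low _ bN) //.
        by apply: (doublingP bN).
      exact: low_lt bN ke ok.
    split; rewrite ?mul0n ?add0n ?mul1n -?(Kc3_low _ bN') //.
      by apply: (doublingP bN').
    exact: low_lt bN' ke ok.
  have agree := @pairs_splits b b' N 4 (pairs_agree2 bN bN').
  have [a [d [q [st st']]]] := step_agree c bN bN' agree (isT : 1 < 4).
  have qE : q = 2 by case: st => _ _ [->|->].
  rewrite qE in st st'.
  have l := @step_levels b N 3 4 c a d 2 bN isT isT st.
  have l' := @step_levels b' N 3 4 c a d 2 bN' isT isT st'.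
  exists a, 0, 1, ((d + N.-1) %% N), 0; split=> //; first exact: eps0_ok.
    by rewrite -(Kc2_low _ bN).
  by rewrite -(Kc2_low _ bN').
have [A1 [A1' [k1 [v1 [s1 [Ak1 ok1 l1 l1']]]]]] := key c1 p1 p1g.
have [A2 [A2' [k2 [v2 [s2 [Ak2 ok2 l2 l2']]]]]] := key c2 p2 p2g.
have [A3 [A3' [k3 [v3 [s3 [Ak3 ok3 l3 l3']]]]]] := key e1 q1 q1g.
have [A4 [A4' [k4 [v4 [s4 [Ak4 ok4 l4 l4']]]]]] := key e2 q2 q2g.
rewrite (levels_le l1 l2 l3 l4) (levels_le l1' l2' l3' l4').
case: (A1' + A2' =P A3' + A4') => // AE; congr (_ || _ && (_ || _)).
by apply: (low_agree bN bN') => //; clear -AE Ak1 Ak2 Ak3 Ak4; lia.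
Qed.

(** From [g = 3] the step would lead down to 1, so both 2 and 3 are base cases. *)
Lemma pairs_agreeP b b' N g : residue_count b N -> residue_count b' N -> 1 < g ->
  pairs_agree b b' g.
Proof.
move=> bN bN'; elim/ltn_ind: g => g IH g_gt1.
have [->|[->|g_gt3]] : g = 2 \/ g = 3 \/ 3 < g by clear -g_gt1; lia.
- exact: pairs_agree2 bN bN'.
- exact: pairs_agree3 bN bN'.
by apply: (pairs_agree_step bN bN'); [|apply: pairs_splits|apply: pairs_splits|];
  rewrite ?(ltnW g_gt3) //; apply: IH; clear -g_gt3; lia.
Qed.

Lemma splits_agreeP b b' N n : residue_count b N -> residue_count b' N -> 1 < n ->
  splits_agree b b' N n.
Proof.
move=> bN bN' n_gt1.
have [->|[->|n_gt3]] : n = 2 \/ n = 3 \/ 3 < n by clear -n_gt1; lia.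
- exact: splits_agree2 bN bN'.
- exact: splits_agree3 bN bN'.
by apply/pairs_splits/(pairs_agreeP bN bN'); clear -n_gt3; lia.
Qed.

(** * Transfer of representations *)

Definition valid_terms N t (alpha nu : nat -> nat) :=
  [/\ forall j, 1 <= j <= t -> 1 <= alpha j <= N,
      forall j, 1 <= j < t -> nu j.+1 < nu j & 0 < t -> 1 < nu t].

Lemma valid_terms_shift N t alpha nu : valid_terms N t.+1 alpha nu ->
  valid_terms N t (alpha \o succn) (nu \o succn).
Proof.
case=> aN dec last; split=> [j /andP[_ jt]|j /andP[_ jt]|t_gt0] /=; first by apply: aN.
  by apply: dec.
by apply: last.
Qed.

Lemma valid_terms_first N t alpha nu : valid_terms N t.+1 alpha nu -> 1 < nu 1.
Proof.
elim: t alpha nu => [|t IH] alpha nu val; first by case: val => _ _; apply.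
have := IH _ _ (valid_terms_shift val); case: val => _ dec _ /=.
by have := dec 1 isT; clear; lia.
Qed.

Lemma sum_shift t (G : nat -> nat) :
  \sum_(1 <= j < t.+2) G j = G 1 + \sum_(1 <= j < t.+1) G j.+1.
Proof. by rewrite big_nat_recl // big_add1. Qed.

(** Coefficients up to [N] act as digits on the scale [calB]: by [calB_succ_ge] they never reach the
    place after the first. *)
Lemma terms_lt b N t alpha nu e : residue_count b N -> valid_terms N t alpha nu ->
  \sum_(1 <= j < t.+1) alpha j * calB b (nu j) + Kres b (2 * e) 1 <
    calB b (if t is 0 then 2 else (nu 1).+1).
Proof.
move=> bN; elim: t alpha nu => [|t IH] alpha nu val.
  rewrite big_geq // add0n (Kc1 bN); have := calB_ge bN (isT : 1 < 2).
  by have := ltn_pmod e (N_gt0 bN); move: (e %% N); clear; lia.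
have := IH _ _ (valid_terms_shift val); have nu1 := valid_terms_first val.
rewrite sum_shift -addnA /=; move: (_ + Kres b _ 1) => R R_lt.
have R_lt' : R < calB b (nu 1).
  apply: leq_trans R_lt _; apply: (calB_mono bN); case: t val {IH} => [|t] val //=.
  have := valid_terms_first (valid_terms_shift val).
  by case: val => _ /(_ 1 isT) dec _ /=; rewrite ltnS dec andbT => /ltnW.
apply: leq_trans (calB_succ_ge bN nu1); rewrite mulSn addnC -addSn.
by apply: leq_add => //; rewrite leq_mul2r; case: val => /(_ 1 isT)/andP[_ ->]; rewrite orbT.
Qed.

(** Induction on [t]: the first term is matched with the step of the recursion at [n], common to
    both bases, and the remaining terms then represent the remainder [Kres b (2 * d) p]. *)
Lemma terms_transfer b b' N n t alpha nu c e :
  residue_count b N -> residue_count b' N -> 0 < n ->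
  valid_terms N t alpha nu -> (0 < t -> nu 1 = n) ->
  Kres b (2 * c) n = \sum_(1 <= j < t.+1) alpha j * calB b (nu j) + Kres b (2 * e) 1 ->
  Kres b' (2 * c) n = \sum_(1 <= j < t.+1) alpha j * calB b' (nu j) + Kres b' (2 * e) 1.
Proof.
move=> bN bN'; elim: t alpha nu n c => [|t IH] alpha nu n c n_gt0 val nu1.
  rewrite !big_geq // !add0n => E.
  have n1 : n = 1 by rewrite -(F_Kc bN c n_gt0) E (F_Kc bN).
  rewrite n1 in E *; apply: (Kc_mod bN'); apply/(doubleP bN).
  by rewrite -(Kc_res bN c (isT : 0 < 1)) E (Kc_res bN).
have {}nu1 := nu1 isT; have n_gt1 : 1 < n by rewrite -nu1; apply: valid_terms_first val.
have val' := valid_terms_shift val; have := terms_lt e bN val'.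
have [a [d [p [st st']]]] := step_agree c bN bN' (splits_agreeP bN bN' n_gt1) n_gt1.
case: st => _ dN pn -> Kd_lt; case: st' => _ _ _ -> _.
rewrite !sum_shift nu1 -!addnA => R_lt E.
have p_gt0 : 0 < p by case: pn => ->; clear -n_gt1; lia.
have R_lt' : \sum_(1 <= j < t.+1) (alpha \o succn) j * calB b ((nu \o succn) j) +
    Kres b (2 * e) 1 < calB b n.
  apply: leq_trans R_lt _; apply: (calB_mono bN); case: t val val' {IH E} => [|t] val val' //=.
  rewrite -nu1; have := valid_terms_first val'.
  by case: val => _ /(_ 1 isT) dec _ /=; rewrite ltnS dec andbT => /ltnW.
have [aE RE] : a = alpha 1 /\ Kres b (2 * d) p = \sum_(1 <= j < t.+1)
    (alpha \o succn) j * calB b ((nu \o succn) j) + Kres b (2 * e) 1.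
  have B0 : 0 < calB b n by apply: leq_trans Kd_lt.
  have aE : a = alpha 1.
    by have := congr1 (divn^~ (calB b n)) E; rewrite !divnMDl // !divn_small // !addn0.
  by split=> //; move: E; rewrite aE => /addnI.
rewrite aE; congr (_ + _); apply: (IH (alpha \o succn) (nu \o succn)) => //.
move=> t_gt0; case: t t_gt0 val' R_lt RE {IH E R_lt' val} => // t _ val' R_lt RE.
have nu2 := valid_terms_first val'.
have [al2 _ _] := val'; have {al2} /andP[al2 _] := al2 1 isT.
(* The size of the remainder fixes its first index: [nu 2 < p] would put the sum below [calB b p],
   and [p < nu 2] would make it at least [calB b p.+1]. *)
case: (ltngtP (nu 2) p) => // lt.
  have := calB_mono bN (_ : 1 < (nu 2).+1 <= p).
  rewrite ltnS lt (ltnW nu2) => /(_ isT) le.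
  have := calB_le bN d (_ : 1 < p); rewrite (leq_trans nu2 (ltnW lt)) => /(_ isT) ge.
  by move: R_lt; rewrite -RE ltnNge (leq_trans le ge).
have p_small : Kres b (2 * d) p < calB b p.+1.
  case: (leqP p 1) => p1; last by have := doublingP bN p1 d; clear; lia.
  have -> : p = 1 by apply/eqP; rewrite eqn_leq p1.
  rewrite (Kc1 bN); have := calB_ge bN (isT : 1 < 2).
  by have := ltn_pmod d (N_gt0 bN); move: (d %% N); clear; lia.
have := calB_mono bN (_ : 1 < p.+1 <= nu 2); rewrite ltnS p_gt0 lt => /(_ isT) le.
move: p_small; rewrite RE sum_shift -addnA ltnNge /= => /negP[].
apply: leq_trans le _; apply: leq_trans (leq_addr _ _).
by rewrite leq_pmull.
Qed.

Lemma residue_count_even m : 0 < m -> residue_count (2 * m) (2 * m - 1).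
Proof. by move=> m_gt0; split; [|left]; lia. Qed.

Lemma residue_count_odd m : 0 < m -> residue_count (4 * m - 1) (2 * m - 1).
Proof. by move=> m_gt0; split; [|right]; lia. Qed.

Lemma alpha_maxE b N : residue_count b N -> alpha_max b = N.
Proof. by case=> _ [[-> oddN]|->]; rewrite /alpha_max /= ?oddN ?odd_double ?doubleK. Qed.

(** Symmetric in the two bases, so that it serves both directions; the indices enter through the
    numbers [c] and [e] that both bases share. *)
Lemma representation_transfer b b' N n i i' t alpha nu beta beta' c e :
    residue_count b N -> residue_count b' N -> 0 < n -> index_set b' beta' ->
    (forall k, Kres b i k = Kres b (2 * c) k) -> Kres b beta 1 = Kres b (2 * e) 1 ->
    (forall k, Kres b' i' k = Kres b' (2 * c) k) -> Kres b' beta' 1 = Kres b' (2 * e) 1 ->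
  is_representation b n i t alpha nu beta ->
  is_representation b' n i' t alpha nu beta'.
Proof.
move=> bN bN' n_gt0 beta_in ic be ic' be' [].
rewrite ic be => E al _ nuP; rewrite (alpha_maxE bN) in al.
split=> //; last by rewrite (alpha_maxE bN').
rewrite ic' be'; apply: (terms_transfer bN bN') E => //; last by case/nuP.
split=> // [j jt|t_gt0]; last by case: (nuP t_gt0) => _ _ [->|->].
by case: (nuP _) => [|_ /(_ j jt)[]//]; case/andP: jt; clear; lia.
Qed.

Theorem theorem7p3 (m : nat) (hm : 1 <= m) (n : nat) (hn : 1 <= n)
    (i : nat) (hi : index_set (4 * m - 1) i)
    (t : nat) (alpha nu : nat -> nat)
    (beta : nat) (hbeta : index_set (4 * m - 1) beta) :
  is_representation (2 * m) n (residue_iso m i) t alpha nu (residue_iso m beta)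
  <->
  is_representation (4 * m - 1) n i t alpha nu beta.
Proof.
have bN := residue_count_even hm; have bN' := residue_count_odd hm.
have even_index j : index_set (4 * m - 1) j -> j = 2 * j./2.
  have odd_b : odd (4 * m - 1) by lia.
  rewrite /index_set odd_b => /andP[_ /= j_even].
  by rewrite -{1}(odd_double_half j) (negbTE j_even) mul2n.
(* Reduction modulo [2 * m - 1] does not affect [Kres (2 * m)], so half of the even representative
   is a common class for both bases. *)
have iso j k : index_set (4 * m - 1) j ->
    Kres (2 * m) (residue_iso m j) k = Kres (2 * m) (2 * j./2) k.
  by move=> /even_index <-; rewrite /Kres /residue_iso -subn1 modn_mod.
have odd_res j k : index_set (4 * m - 1) j ->
    Kres (4 * m - 1) j k = Kres (4 * m - 1) (2 * j./2) k.
  by move=> /even_index <-.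
split; apply: (@representation_transfer _ _ (2 * m - 1) _ _ _ _ _ _ _ _ i./2 beta./2) => //;
  try by [move=> k; apply: iso|move=> k; apply: odd_res|apply: iso|apply: odd_res].
exact: residue_iso_index_set.
Qed.
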